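(* Let $(X,Y)$ be a random pair with $Y\in\{-1,+1\}$, $P_X$ the law of $X$, $\eta(x)=\mathbb{P}(Y=+1\mid X=x)$, and assume $\eta(X)\in(0,1)$ $P_X$-almost surely. Then, under the coarsened operator $\mathcal{O}_{\mathrm{class}}$, all losses in $\mathscr{L}_{\mathrm{margin}}^{\mathrm{calib}}$ belong to a single realizable exclusivity class within $\mathscr{L}_{\mathrm{margin}}^{\mathrm{calib}}$ (equivalently, to a single identification component of the graph $G_{\mathcal{O}_{\mathrm{class}}}$). Equivalently, for any $L_\phi,L_\psi\in\mathscr{L}_{\mathrm{margin}}^{\mathrm{calib}}$, $\mathcal{O}_{\mathrm{class}}(L_\phi)=\mathcal{O}_{\mathrm{class}}(L_\psi)$ up to $P_X$-null sets and the tie set $T:=\{x:\eta(x)=1/2\}$.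
   Context: A margin loss has the form $L_\phi(y,t)=\phi(yt)$ with $\phi:\mathbb{R}\to[0,\infty)$. For $\eta\in(0,1)$ let $C_\eta(\alpha)=\eta\phi(\alpha)+(1-\eta)\phi(-\alpha)$. The loss $\phi$ is classification-calibrated if for every $\eta\in(0,1)\setminus\{1/2\}$ every minimizer $\alpha^*(\eta)$ of $C_\eta$ satisfies $\mathrm{sign}(\alpha^*(\eta))=\mathrm{sign}(\eta-1/2)$. $\mathscr{L}_{\mathrm{margin}}^{\mathrm{calib}}$ is the family of margin losses with $\phi$ convex and classification-calibrated. $\mathcal{O}_{\mathrm{score}}(L_\phi)$ is the set of Bayes-optimal score functions, i.e. measurable $f:\mathcal{X}\to\mathbb{R}$ such that $f(x)$ minimizes $C_{\eta(x)}$ for $P_X$-a.e. $x$. The coarsened operator is $\mathcal{O}_{\mathrm{class}}(L_\phi):=\{\mathrm{sign}(f):f\in\mathcal{O}_{\mathrm{score}}(L_\phi)\}$, where two sign rules are identified if they agree $P_X$-a.s. outside $T$. For an operator $\mathcal{O}$ assigning to each loss in an ambient family $\mathcal{M}$ a set of decision rules: $\mathcal{C}\subseteq\mathcal{M}$ is an exclusivity region within $\mathcal{M}$ if no decision rule $\delta$ belongs to $\mathcal{O}(L)$ for some $L\in\mathcal{C}$ and also to $\mathcal{O}(L')$ for some $L'\in\mathcal{M}\setminus\mathcal{C}$. An exclusivity class within $\mathcal{M}$ for $\delta$ is a maximal exclusivity region $\mathcal{C}$ within $\mathcal{M}$ with $\mathcal{C}\subseteq\{L:\delta\in\mathcal{O}(L)\}$;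 it is realizable if it contains a loss $L$ with $\mathcal{O}(L)\ne\emptyset$. The identification graph $G_{\mathcal{O}}$ on the losses joins $L$ and $L'$ whenever $\mathcal{O}(L)\cap\mathcal{O}(L')\neq\emptyset$; identification components are its connected components. *)

(* Defs.v *)
From HB Require Import structures.
From mathcomp Require Import all_boot all_order all_algebra.
From mathcomp Require Import all_classical all_reals all_analysis.
From Stdlib Require Import Relation_Operators.

Set Implicit Arguments.
Unset Strict Implicit.
Unset Printing Implicit Defensive.

Import Order.TTheory GRing.Theory Num.Theory.
Import numFieldNormedType.Exports.

Local Open Scope classical_set_scope.
Local Open Scope ring_scope.

Section Margin.
Variable R : realType.

(* A loss takes a label and a score. Labels are the reals 1 and -1; the values
   at other labels are never used, and phi is recovered from margin_loss phi at
   label 1. *)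
Definition margin_loss (phi : R -> R) : R -> R -> R := fun y t => phi (y * t).

Definition cond_risk (L : R -> R -> R) (eta alpha : R) : R :=
  eta * L 1 alpha + (1 - eta) * L (-1) alpha.

Lemma cond_risk_margin (phi : R -> R) (eta alpha : R) :
  cond_risk (margin_loss phi) eta alpha =
  eta * phi alpha + (1 - eta) * phi (- alpha).
Proof. by rewrite /cond_risk /margin_loss mul1r mulN1r. Qed.

Definition minimizer (C : R -> R) (alpha : R) : Prop :=
  forall beta, C alpha <= C beta.

(* Num.sg is the three-valued sign, so a minimizer equal to 0 violates
   calibration. *)
Definition classification_calibrated (phi : R -> R) : Prop :=
  forall eta : R, 0 < eta < 1 -> eta <> 2^-1 ->
  forall alpha : R, minimizer (cond_risk (margin_loss phi) eta) alpha ->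
    Num.sg alpha = Num.sg (eta - 2^-1).

Definition calib_convex (phi : R -> R) : Prop :=
  [/\ forall t, 0 <= phi t,
      convex_function [set: R^o] phi &
      classification_calibrated phi].

Definition margin_calib : set (R -> R -> R) :=
  [set L | exists2 phi, calib_convex phi & L = margin_loss phi].

End Margin.

Section Exclusivity.
Variables (Loss Rule : Type) (M : set Loss) (O : Loss -> set Rule).

Definition exclusivity_region (C : set Loss) : Prop :=
  C `<=` M /\
  ~ exists delta L L',
      [/\ C L, O L delta, (M `\` C) L' & O L' delta].

Definition exclusivity_class (delta : Rule) (C : set Loss) : Prop :=
  [/\ exclusivity_region C,
      C `<=` [set L | O L delta] &
      forall D, exclusivity_region D -> D `<=` [set L | O L delta] ->
        C `<=` D -> D = C].

Definition realizable (C : set Loss) : Prop :=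
  exists2 L, C L & O L !=set0.

Definition ident_edge (L L' : Loss) : Prop :=
  [/\ M L, M L' & (O L `&` O L') !=set0].

Definition ident_component (K : set Loss) : Prop :=
  exists2 L, M L &
    K = [set L' | M L' /\ clos_refl_sym_trans Loss ident_edge L L'].

End Exclusivity.

Section Operators.
Context (R : realType) (dX : measure_display) (T : measurableType dX).
Variables (PX : probability T R) (eta : T -> R).

Definition score_opt (L : R -> R -> R) : set (T -> R) :=
  [set f | measurable_fun [set: T] f /\
           {ae PX, forall x, minimizer (cond_risk L (eta x)) (f x)}].

Definition tie_set : set T := [set x | eta x = 2^-1].

Definition sign_of (f : T -> R) : T -> R := fun x => Num.sg (f x).

Definition sign_rule (g : T -> R) : Prop :=
  exists2 f, measurable_fun [set: T] f & g = sign_of f.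

Definition rule_eq (g h : T -> R) : Prop :=
  {ae PX, forall x, ~ tie_set x -> g x = h x}.

(* Decision rules are sign rules modulo rule_eq, encoded as equivalence
   classes. *)
Definition rule_class (g : T -> R) : set (T -> R) :=
  [set h | sign_rule h /\ rule_eq g h].

Definition class_opt (L : R -> R -> R) : set (set (T -> R)) :=
  [set rule_class (sign_of f) | f in score_opt L].

End Operators.

Section Regression.
Context (R : realType) (d dX : measure_display) (Omega : measurableType d)
  (T : measurableType dX) (P : probability Omega R).

(* eta is a version of x |-> P(Y = 1 | X = x). *)
Definition regression_function (X : {RV P >-> T}) (Y : {RV P >-> R})
    (eta : T -> R) : Prop :=
  [/\ measurable_fun [set: T] eta,
      (distribution P X).-integrable [set: T] (EFin \o eta) &
      forall A : set T, measurable A ->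
        P (X @^-1` A `&` Y @^-1` [set 1]) =
        (\int[distribution P X]_(x in A) (eta x)%:E)%E].

End Regression.

(* Main.v *)
(* Calibration forces sign(f) = sign(eta - 1/2) almost everywhere off the tie set
   for every Bayes-optimal score f of every calibrated loss, so two operators agree
   as soon as each loss has at least one measurable Bayes-optimal score. To build
   one, note that a calibrated convex phi is not constant, hence the conditional
   risk C_e is coercive for 0 < e < 1 and, being convex and continuous, has a least
   minimizer m(e). By convexity m(e) <= c iff C_e(c) <= C_e(b) for all b >= c, an
   intersection of half-lines in e, so m is measurable and m o eta is optimal. *)

Require Import Defs.
From HB Require Import structures.
From mathcomp Require Import all_boot all_order all_algebra.
From mathcomp Require Import all_classical all_reals all_analysis.
From mathcomp Require Import measurable_realfun lra ring.
From Stdlib Require Import Relation_Operators.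
Import Order.TTheory GRing.Theory Num.Theory.
Import numFieldNormedType.Exports.
Local Open Scope classical_set_scope.
Local Open Scope ring_scope.

(** * Convex functions on the real line *)

Section ConvexReal.
Context {R : realType}.
Implicit Types (f : R -> R) (x y z s : R).

Lemma convex_functionP f :
  convex_function [set: R^o] f <->
  forall s x y, 0 <= s <= 1 ->
    f (s * x + (1 - s) * y) <= s * f x + (1 - s) * f y.
Proof.
split=> [cf s x y /andP[s0 s1] | cf t x y _ _].
  by have := cf (Itv01 s0 s1) x y (in_setT _) (in_setT _).
by apply: (cf t%:num x y); rewrite ge0 le1.
Qed.

(** Clearing the denominators of the chord inequality keeps it meaningful when points coincide. *)
Lemma convex_three_points f x y z : convex_function [set: R^o] f ->
  x <= y <= z -> (z - x) * f y <= (z - y) * f x + (y - x) * f z.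
Proof.
move=> /convex_functionP cf /andP[xy yz].
have [xz|xz] := ltP x z; last first.
  have -> : y = x by lra.
  have -> : z = x by lra.
  by rewrite subrr !mul0r addr0.
have zx0 : z - x != 0 by rewrite subr_eq0 gt_eqF.
have zx : 0 < z - x by lra.
have s01 : 0 <= (z - y) / (z - x) <= 1.
  by rewrite divr_ge0 ?ler_pdivrMr //=; lra.
have := cf _ x z s01.
have -> : (z - y) / (z - x) * x + (1 - (z - y) / (z - x)) * z = y by field.
rewrite -(ler_pM2l zx) => /le_trans; apply.
by rewrite le_eqVlt; apply/orP; left; apply/eqP; field.
Qed.

Lemma convex_function_opp f :
  convex_function [set: R^o] f -> convex_function [set: R^o] (f \o -%R).
Proof.
move=> /convex_functionP cf; apply/convex_functionP => s x y s01 /=.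
by rewrite opprD -!mulrN; exact: cf.
Qed.

(** For [0 <= h], the chord over [[x, x + 1]] bounds [f (x + h)] from above, and [x] lying between
    [x - 1] and [x + h] bounds it from below. *)
Lemma convex_local_lipschitz f x h : convex_function [set: R^o] f ->
  `|h| <= 1 ->
  `|f (x + h) - f x| <= `|h| * (`|f (x + 1) - f x| + `|f (x - 1) - f x|).
Proof.
move=> cf.
(* Reflecting [f] swaps the roles of [x + 1] and [x - 1], which the bound treats alike. *)
wlog h0 : f x h cf / 0 <= h.
  move=> H; have [|/ltW h0] := leP 0 h; first exact: H.
  have := H _ (- x) (- h) (convex_function_opp _ cf).
  rewrite normrN /= !opprD !opprK [in X in _ -> X](addrC `|f (x + 1) - _|).
  by apply; rewrite oppr_ge0.
rewrite ger0_norm // => h1.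
have U : f (x + h) - f x <= h * (f (x + 1) - f x).
  have /(_ x (x + h) (x + 1)) := convex_three_points _ _ _ _ cf.
  have -> : x <= x + h <= x + 1 by lra.
  by move=> /(_ isT); lra.
have L : f x - f (x + h) <= h * (f (x - 1) - f x).
  have := convex_three_points _ (x - 1) x (x + h) cf.
  have -> : x - 1 <= x <= x + h by lra.
  by move=> /(_ isT); lra.
have U' : h * (f (x + 1) - f x) <= h * `|f (x + 1) - f x|.
  by rewrite ler_wpM2l // ler_norm.
have L' : h * (f (x - 1) - f x) <= h * `|f (x - 1) - f x|.
  by rewrite ler_wpM2l // ler_norm.
have P1 : 0 <= h * `|f (x + 1) - f x| by rewrite mulr_ge0.
have P2 : 0 <= h * `|f (x - 1) - f x| by rewrite mulr_ge0.
by rewrite ler_norml; lra.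
Qed.

Lemma convex_continuous f : convex_function [set: R^o] f -> continuous f.
Proof.
move=> cf x; set K := `|f (x + 1) - f x| + `|f (x - 1) - f x|.
(* [K] may vanish, so the radius is taken with [K + 1]. *)
have K1 : 0 < K + 1 by rewrite ltr_wpDl // addr_ge0.
apply/cvgrPdist_le => eps eps0.
have e0 : 0 < Num.min 1 (eps / (K + 1)) by rewrite lt_min ltr01 divr_gt0.
near=> t.
have : `|x - t| <= Num.min 1 (eps / (K + 1)).
  by near: t; exact: (@cvgr_dist_le _ _ _ _ _ id).
rewrite le_min => /andP[xt1 xte].
rewrite distrC -[t](subrKC x).
apply: (le_trans (convex_local_lipschitz _ _ _ cf _)); first by rewrite distrC.
rewrite distrC -/K; apply: (@le_trans _ _ (eps / (K + 1) * (K + 1))).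
  by apply: ler_pM => //; rewrite ?addr_ge0 // lerDl.
by rewrite divfK // gt_eqF.
Unshelve. all: by end_near.
Qed.

(** Past [q] the graph lies above the rising line through its points at [p] and [q]; the threshold
    is where this line reaches [B]. *)
Lemma convex_tends_to_infty f p q : convex_function [set: R^o] f ->
  p < q -> f p < f q -> forall B, exists K, forall x, K <= x -> B <= f x.
Proof.
move=> cf pq fpq B.
exists (Num.max q (p + (q - p) * (B - f p) / (f q - f p))) => x.
rewrite ge_max => /andP[qx].
have fq : 0 < f q - f p by lra.
rewrite -lerBrDl ler_pdivrMr // => Kx.
have := convex_three_points _ p q x cf.
have -> : p <= q <= x by lra.
move=> /(_ isT) H.
have qp : 0 < q - p by lra.
rewrite -(ler_pM2l qp); lra.
Qed.

End ConvexReal.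

(** * Minimizers of the conditional risk *)

Section ConditionalRisk.
Context {R : realType}.
Implicit Types (phi : R -> R) (e alpha beta c : R).

Local Notation C phi e := (cond_risk (margin_loss phi) e).

Lemma convex_cond_risk phi e : convex_function [set: R^o] phi ->
  0 < e < 1 -> convex_function [set: R^o] (C phi e).
Proof.
move=> cphi /andP[e0 e1]; have /convex_functionP cphi' := convex_function_opp _ cphi.
move/convex_functionP: cphi => cphi.
apply/convex_functionP => s x y s01; rewrite !cond_risk_margin.
have H1 := cphi s x y s01; have H2 := cphi' s x y s01.
move: H1; rewrite -(ler_pM2l e0) => H1.
have e1' : 0 < 1 - e by lra.
by move: H2; rewrite -(ler_pM2l e1') /=; lra.
Qed.

(** A constant [phi] makes the risk constant, so 0 is a minimizer at [4^-1], where calibration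
    demands a negative sign. *)
Lemma calib_nonconstant phi : classification_calibrated phi ->
  exists p q, p < q /\ phi p <> phi q.
Proof.
move=> cal; apply: contrapT => H.
have cst x : phi x = phi 0.
  apply: contrapT => xn; apply: H.
  have [x0|x0|x0] := ltgtP x 0; last by rewrite x0 in xn.
    by exists x, 0.
  by exists 0, x; split=> // /esym.
have h34 : 0 < (4^-1 : R) < 1 by lra.
have h34' : (4^-1 : R) <> 2^-1 by move=> ?; lra.
have := cal 4^-1 h34 h34' 0.
rewrite sgr0 => /(_ _)/esym/eqP; rewrite sgr_eq0 subr_eq0 => H'.
apply: h34'; apply/eqP/H' => beta.
by rewrite !cond_risk_margin oppr0 (cst beta) (cst (- beta)).
Qed.

(** A nonconstant convex [phi] is unbounded in some direction. Both [alpha] and [- alpha] carry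
    positive weight, and the other term, being nonnegative, cannot cancel the growth. *)
Lemma cond_risk_coercive phi e : calib_convex phi -> 0 < e < 1 ->
  forall B, exists K, forall alpha, K <= `|alpha| -> B <= C phi e alpha.
Proof.
move=> [phi0 cphi cal] e01 B.
have [p [q [pq npq]]] := calib_nonconstant _ cal.
have cond phi' p' q' e' : (forall t, 0 <= phi' t) ->
    convex_function [set: R^o] phi' -> 0 < e' < 1 -> p' < q' ->
    phi' p' < phi' q' ->
    exists K, forall alpha, K <= `|alpha| -> B <= C phi' e' alpha.
  move=> {e01} phi'0 cphi' /andP[e0 e1] pq' fpq.
  have e1' : 0 < 1 - e' by lra.
  have [K1 HK1] := convex_tends_to_infty _ _ _ cphi' pq' fpq (B / e').
  have [K2 HK2] := convex_tends_to_infty _ _ _ cphi' pq' fpq (B / (1 - e')).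
  exists (Num.max K1 K2) => alpha; rewrite ge_max cond_risk_margin.
  have [a0|a0] := ger0P alpha; move=> /andP[Ka1 Ka2].
    have := HK1 _ Ka1; rewrite ler_pdivrMr // => ?.
    have : 0 <= (1 - e') * phi' (- alpha) by rewrite mulr_ge0 // ltW.
    lra.
  have := HK2 _ Ka2; rewrite ler_pdivrMr // => ?.
  have : 0 <= e' * phi' alpha by rewrite mulr_ge0 // ltW.
  lra.
have [fpq|fpq|//] := ltgtP (phi p) (phi q); first exact: (cond _ p q).
(* Reflecting [phi] and exchanging [e] with [1 - e] turns a descent into a rise, at the cost of no
   change in the risk. *)
have [| ||||K HK] := cond (phi \o -%R) (- q) (- p) (1 - e).
- by move=> t /=.
- exact: convex_function_opp.
- lra.
- by rewrite ltrN2.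
- by rewrite /= !opprK.
exists K => alpha /HK; rewrite !cond_risk_margin /= opprK; lra.
Qed.

Lemma minimizer_exists phi e : calib_convex phi -> 0 < e < 1 ->
  exists alpha, minimizer (C phi e) alpha.
Proof.
move=> cc e01; have [_ cphi _] := cc.
(* The value at 0 as bound confines the search to a compact interval; the maximum with 0 keeps 0
   inside it. *)
have [K HK] := cond_risk_coercive _ _ cc e01 (C phi e 0).
have K0 : 0 <= Num.max K 0 by rewrite le_max lexx orbT.
have [| |a _ Ha] := @EVT_min R (C phi e) (- Num.max K 0) (Num.max K 0).
- lra.
- apply: continuous_subspaceT; apply: convex_continuous.
  exact: convex_cond_risk.
exists a => beta; have [bK|bK] := leP `|beta| (Num.max K 0).
  by apply: Ha; rewrite in_itv /= -ler_norml.
apply: (@le_trans _ _ (C phi e 0)); first by apply: Ha; rewrite in_itv /= oppr_le0 K0.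
by apply: HK; apply: le_trans (ltW bK); rewrite le_max lexx.
Qed.

(* For a convex calibrated phi and 0 < e < 1 this infimum is attained;
   elsewhere it may be the junk value of inf. *)
Definition least_minimizer phi e : R := inf [set alpha | minimizer (C phi e) alpha].

Lemma has_inf_minimizers phi e : calib_convex phi -> 0 < e < 1 ->
  has_inf [set alpha | minimizer (C phi e) alpha].
Proof.
move=> cc e01; have [a Ha] := minimizer_exists _ _ cc e01.
split; first by exists a.
(* The added 1 makes the risk far out strictly exceed its minimum. *)
have [K HK] := cond_risk_coercive _ _ cc e01 (C phi e a + 1).
exists (- Num.max K 0) => b /(_ a) Hb /=; rewrite leNgt; apply/negP => bK.
have /HK : K <= `|b|.
  have b0 : b <= 0 by apply: le_trans (ltW bK) _; rewrite oppr_le0 le_max lexx orbT.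
  by rewrite ler0_norm // lerNr; apply: le_trans (ltW bK) _; rewrite lerN2 le_max lexx.
lra.
Qed.

(** If some [beta] did strictly better than the infimum, continuity would make all points near the
    infimum worse than [beta], among them a minimizer. *)
Lemma least_minimizerP phi e : calib_convex phi -> 0 < e < 1 ->
  minimizer (C phi e) (least_minimizer phi e).
Proof.
move=> cc e01 beta; have [_ cphi _] := cc.
have hi := has_inf_minimizers _ _ cc e01.
rewrite leNgt; apply/negP => lt_beta.
have /cvgrPdist_lt/(_ (C phi e (least_minimizer phi e) - C phi e beta)) :=
  convex_continuous _ (convex_cond_risk _ _ cphi e01) (least_minimizer phi e).
rewrite subr_gt0 => /(_ lt_beta)[/= r r0 Hr].
have [a Ha aI] := inf_adherent r0 hi.
have la : least_minimizer phi e <= a by apply: ge_inf => //; case: hi.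
have := Hr a; rewrite /ball_ /= ler0_norm; last by lra.
move=> /(_ ltac:(rewrite -/(least_minimizer phi e) in aI; lra)) /ltr_normlW.
have := Ha beta; lra.
Qed.

(* Each inequality on the right is affine in e, so the e satisfying all of them
   form an interval; this is what makes least_minimizer measurable. *)
Lemma least_minimizer_le phi e c : calib_convex phi -> 0 < e < 1 ->
  least_minimizer phi e <= c <-> forall beta, c <= beta -> C phi e c <= C phi e beta.
Proof.
move=> cc e01; have [_ cphi _] := cc.
have mP := least_minimizerP _ _ cc e01.
have [_ hlb] := has_inf_minimizers _ _ cc e01.
split=> [mc beta|Hc].
  rewrite le_eqVlt => /predU1P[<-//|cb].
  have := convex_three_points _ (least_minimizer phi e) c beta
    (convex_cond_risk _ _ cphi e01).
  rewrite mc (ltW cb) => /(_ isT) H; rewrite leNgt; apply/negP => lt_b.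
  have mb : 0 < beta - least_minimizer phi e by lra.
  have H1 : (beta - c) * C phi e (least_minimizer phi e)
      <= (beta - c) * C phi e beta.
    by rewrite ler_wpM2l //; lra.
  by move: lt_b; rewrite -(ltr_pM2l mb); lra.
rewrite leNgt; apply/negP => cm.
(* The least minimizer lies to the right of [c], so [c] does at least as well and is a minimizer
   below the infimum. *)
have cmin : minimizer (C phi e) c.
  by move=> beta; apply: le_trans (mP beta); apply/Hc/ltW.
have : least_minimizer phi e <= c by apply: ge_inf.
by rewrite leNgt cm.
Qed.

Lemma measurable_least_minimizer phi : calib_convex phi ->
  measurable_fun (`]0, 1[ : set R) (least_minimizer phi).
Proof.
move=> cc mD.
apply: (measurability _ (RGenOInfty.measurableE R)) => //.
move=> _ [_ [c ->] <-].
have -> : `]0, 1[ `&` least_minimizer phi @^-1` `]c, +oo[ =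
    `]0, 1[ `\` [set e | 0 < e < 1 /\
      forall beta, c <= beta -> C phi e c <= C phi e beta].
  apply/seteqP; split=> e /=; rewrite !in_itv /= andbT.
    move=> [e01 ce]; split=> // -[_ /(least_minimizer_le _ _ _ cc e01)].
    by rewrite leNgt ce.
  move=> [e01 H]; split=> //; rewrite ltNge; apply/negP.
  by move=> /(least_minimizer_le _ _ _ cc e01) ?; apply: H.
apply: measurableD => //; apply: is_interval_measurable.
move=> x y /= [/andP[x0 x1] Hx] [/andP[y0 y1] Hy] z /andP[xz zy].
split=> [|beta cb]; first by apply/andP; split; lra.
have := Hx _ cb; have := Hy _ cb; rewrite !cond_risk_margin => H1 H2.
have [xy|yx] := ltP x y; last first.
  have -> : z = x by lra.
  lra.
have H3 := ler_wpM2l (ltac:(lra) : 0 <= z - x) H1.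
have H4 := ler_wpM2l (ltac:(lra) : 0 <= y - z) H2.
have xy0 : 0 < y - x by lra.
rewrite -(ler_pM2l xy0); nra.
Qed.

(** Provides a member of the family, as realizability and the choice of a base vertex require. *)
Lemma square_loss_calib_convex : calib_convex (fun t : R => (1 - t) ^+ 2).
Proof.
split.
- by move=> t; exact: sqr_ge0.
- apply/convex_functionP => s x y /andP[s0 s1].
  rewrite -subr_ge0 [leRHS](_ : _ = s * (1 - s) * (x - y) ^+ 2); last by ring.
  by rewrite mulr_ge0 ?sqr_ge0 // mulr_ge0 // subr_ge0.
(* Up to a term free of [alpha], the risk is [(alpha - (2 * e - 1)) ^+ 2]; comparison with its root
   forces equality. *)
- move=> e _ _ alpha /(_ (2 * e - 1)); rewrite !cond_risk_margin => H.
  have a0 : (alpha - (2 * e - 1)) ^+ 2 = 0.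
    by apply/eqP; rewrite eq_le sqr_ge0 andbT; lra.
  move/eqP: a0; rewrite sqrf_eq0 subr_eq0 => /eqP ->.
  rewrite [X in Num.sg X](_ : _ = 2 * (e - 2^-1)); last by lra.
  by rewrite sgrM gtr0_sg // mul1r.
Qed.

End ConditionalRisk.

(** * Bayes-optimal scores and their sign classes *)

Section ClassOpt.
Context {R : realType} {dX : measure_display} {T : measurableType dX}.
Context {PX : probability T R} {eta : T -> R}.
Hypothesis meta : measurable_fun [set: T] eta.
Hypothesis eta01 : {ae PX, forall x, 0 < eta x < 1}.
Implicit Types (phi psi : R -> R) (g h : T -> R).

Lemma score_opt_nonempty phi : calib_convex phi ->
  score_opt PX eta (margin_loss phi) !=set0.
Proof.
(* The score must be measurable on all of [T], while [eta] lies in the open unit interval only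
   almost everywhere; the restriction supplies a default value elsewhere. *)
move=> cc; exists ((least_minimizer phi \_ `]0, 1[) \o eta); split.
  apply: measurableT_comp => //.
  apply: (measurable_restrictT _ _).1 => //.
  exact: measurable_least_minimizer.
apply: filterS eta01 => x e01 /=.
by rewrite patchE mem_set /= ?in_itv //; exact: least_minimizerP.
Qed.

(** The target sign does not involve [phi], which makes different losses comparable; calibration is
    silent on the tie set. *)
Lemma score_opt_sign phi f : calib_convex phi ->
  score_opt PX eta (margin_loss phi) f ->
  rule_eq PX eta (sign_of f) (fun x => Num.sg (eta x - 2^-1)).
Proof.
move=> [_ _ cal] [_ fmin]; apply: filterS2 eta01 fmin => x e01 fm nT.
exact: cal.
Qed.

Lemma rule_eq_sym g h : rule_eq PX eta g h -> rule_eq PX eta h g.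
Proof. by apply: filterS => x H /H. Qed.

Lemma rule_eq_trans g h k :
  rule_eq PX eta g h -> rule_eq PX eta h k -> rule_eq PX eta g k.
Proof. by apply: filterS2 => x gh hk nT; rewrite gh // hk. Qed.

Lemma rule_class_eq g h :
  rule_eq PX eta g h -> rule_class PX eta g = rule_class PX eta h.
Proof.
move=> gh; apply/seteqP; split=> k [sk gk]; split=> //.
  exact: rule_eq_trans (rule_eq_sym _ _ gh) gk.
exact: rule_eq_trans gh gk.
Qed.

Lemma class_opt_eq phi psi : calib_convex phi -> calib_convex psi ->
  class_opt PX eta (margin_loss phi) = class_opt PX eta (margin_loss psi).
Proof.
suff sub phi' psi' : calib_convex phi' -> calib_convex psi' ->
    class_opt PX eta (margin_loss phi') `<=` class_opt PX eta (margin_loss psi').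
  by move=> cphi cpsi; apply/seteqP; split; exact: sub.
move=> cphi cpsi _ [f fopt <-].
(* Existence is essential here: an optimal score for [psi'] is needed to represent the same
   class. *)
have [g gopt] := score_opt_nonempty _ cpsi.
exists g => //; apply: rule_class_eq.
apply: rule_eq_trans (score_opt_sign _ _ cpsi gopt) _.
exact: rule_eq_sym (score_opt_sign _ _ cphi fopt).
Qed.

End ClassOpt.

(** * Exclusivity when the operator is constant on the family *)

Section ConstantOperator.
Context {Loss Rule : Type} {M : set Loss} {O : Loss -> set Rule}.
Context {L0 : Loss} {delta : Rule}.
Hypothesis ML0 : M L0.
Hypothesis OL0 : O L0 delta.
Hypothesis O_const : forall L, M L -> O L = O L0.

(** No loss lies in [M] minus itself, so exclusivity is vacuous; every region lies in [M], which
    gives maximality. *)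
Lemma exclusivity_class_constant : exclusivity_class M O delta M.
Proof.
split.
- by split=> // -[_ [_ [L' [_ _ [ML' nML'] _]]]].
- by move=> L /O_const /= ->.
- by move=> D [DM _] _ MD; apply/seteqP.
Qed.

(** The rule [delta] belongs to every [O L] with [L] in [M], so a single edge from [L0] reaches each
    loss. *)
Lemma ident_component_constant : ident_component M O M.
Proof.
exists L0 => //; apply/seteqP; split=> [L ML|L []//]; split=> //.
by apply: rst_step; split=> //; exists delta; split=> //; rewrite O_const.
Qed.

End ConstantOperator.

Theorem proposition2 (R : realType) (d dX : measure_display)
    (Omega : measurableType d) (T : measurableType dX)
    (P : probability Omega R) (X : {RV P >-> T}) (Y : {RV P >-> R})
    (eta : T -> R)
    (hY : forall w, Y w = 1 \/ Y w = -1)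
    (heta : regression_function X Y eta)
    (heta01 : {ae distribution P X, forall x, 0 < eta x < 1}) :
  let M := @margin_calib R in
  let O := class_opt (distribution P X) eta in
  [/\ exists C, [/\ exists delta, exclusivity_class M O delta C,
                    realizable O C &
                    forall L, M L -> C L],
      exists2 K, ident_component M O K & forall L, M L -> K L &
      forall phi psi : R -> R, calib_convex phi -> calib_convex psi ->
        O (margin_loss phi) = O (margin_loss psi)].
Proof.
move=> M O; have [meta _ _] := heta.
have O_eq phi psi : calib_convex phi -> calib_convex psi ->
    O (margin_loss phi) = O (margin_loss psi).
  exact: class_opt_eq.
have sq := @square_loss_calib_convex R.
set L0 := margin_loss (fun t : R => (1 - t) ^+ 2).
have ML0 : M L0 by exists (fun t => (1 - t) ^+ 2).
have [f fopt] := score_opt_nonempty meta heta01 _ sq.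
have OL0 : O L0 (rule_class (distribution P X) eta (sign_of f)) by exists f.
have O_const L : M L -> O L = O L0 by move=> [phi cphi ->]; exact: O_eq.
split=> //.
- exists M; split=> //.
  + eexists; exact: exclusivity_class_constant OL0 O_const.
  + by exists L0 => //; eexists; exact: OL0.
- exists M => //; exact: ident_component_constant ML0 OL0 O_const.
Qed.
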